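(* Let $k\in\mathbb{N}$ with $k\ge 3$ and let $n$ be a positive integer. There exists a bijection $$\vartheta\colon \mathcal{P}_k(n)\longrightarrow \mathcal{B}_k(n-1)$$ such that for every $\pi\in\mathcal{P}_k(n)$ and all $i,j$: $(i,j)$ is an arc of $\pi$ if and only if $(i,j-1)$ is an arc of $\vartheta(\pi)$.
   Context: Notation: $[m]=\{1,\dots,m\}$. A set partition of $[n]$ is represented as a diagram on the vertices $1,\dots,n$ (drawn on a horizontal line) whose arcs are the pairs $(i,j)$ with $i<j$ such that $i$ and $j$ lie in the same block and no element of that block lies strictly between them. Thus every vertex is the left endpoint of at most one arc and the right endpoint of at most one arc. Such a partition is $k$-noncrossing if there are no $k$ arcs $(i_1,j_1),\dots,(i_k,j_k)$ with $i_1<i_2<\dots<i_k<j_1<j_2<\dots<j_k$. $\mathcal{P}_k(n)$ denotes the set of $k$-noncrossing set partitions of $[n]$. A braid over $[m]$ is a set of arcs $(i,j)$ with $1\le i\le j\le m$ (an arc $(j,j)$ is a loop) such that every vertex is the left endpoint of at most one arc and the right endpoint of at most one arc, where a loop $(j,j)$ counts as both a left and a right endpoint at $j$. Here a vertex $j$ that is the right endpoint of an arc $(i,j)$ and the left endpoint of an arc $(j,h)$, $i<j<h$, has these two arcs regarded as crossing each other. A braid is $k$-noncrossing if there are no $k$ arcs $(i_1,j_1),\dots,(i_k,j_k)$ with $i_1<i_2<\dots<i_k\le j_1<j_2<\dots<j_k$. $\mathcal{B}_k(m)$ denotes the set of $k$-noncrossing braids over $[m]$ (with $\mathcal{B}_k(0)$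 consisting of the empty braid). *)

(* Defs.v *)
From HB Require Import structures.
From mathcomp Require Import all_boot.

Set Implicit Arguments.
Unset Strict Implicit.
Unset Printing Implicit Defensive.

(* The vertex [v : 'I_n] stands for the integer v.+1,
   so that 'I_n encodes {1, ..., n}; order relations between vertices are
   unaffected by the shift. *)

(* (i, j) are labels in {1, ..., n}; it is false if i or j is not such a
   label, in particular if i = 0 or j = 0. *)
Definition has_arc (n : nat) (A : {set 'I_n * 'I_n}) (i j : nat) : bool :=
  [exists a in A, (a.1.+1 == i) && (a.2.+1 == j)].

Definition partition_arcs (n : nat) (P : {set {set 'I_n}}) :
    {set 'I_n * 'I_n} :=
  [set a : 'I_n * 'I_n | (a.1 < a.2) &&
    [exists B in P, [&& a.1 \in B, a.2 \in B &
                     [forall l in B, ~~ (a.1 < l < a.2)]]]].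

Definition left_ends (n : nat) (s : seq ('I_n * 'I_n)) : seq nat :=
  [seq val a.1 | a <- s].

Definition right_ends (n : nat) (s : seq ('I_n * 'I_n)) : seq nat :=
  [seq val a.2 | a <- s].

(* i_1 < ... < i_k < j_1 < ... < j_k *)
Definition partition_noncrossing (k n : nat) (P : {set {set 'I_n}}) : bool :=
  ~~ [exists s : k.-tuple ('I_n * 'I_n),
        all (mem (partition_arcs P)) s && sorted ltn (left_ends s ++ right_ends s)].

Definition is_braid (m : nat) (A : {set 'I_m * 'I_m}) : bool :=
  [&& [forall a in A, a.1 <= a.2],
      [forall a in A, forall b in A, (a.1 == b.1) ==> (a == b)] &
      [forall a in A, forall b in A, (a.2 == b.2) ==> (a == b)]].

(* i_1 < ... < i_k <= j_1 < ... < j_k; the default value 0 of [last] and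
   [head] is irrelevant for k > 0. *)
Definition braid_noncrossing (k m : nat) (A : {set 'I_m * 'I_m}) : bool :=
  ~~ [exists s : k.-tuple ('I_m * 'I_m),
        [&& all (mem A) s, sorted ltn (left_ends s),
            last 0 (left_ends s) <= head 0 (right_ends s) &
            sorted ltn (right_ends s)]].

Definition kpartition (k n : nat) : Type :=
  {P : {set {set 'I_n}} | partition P [set: 'I_n] && partition_noncrossing k P}.

Definition kbraid (k m : nat) : Type :=
  {A : {set 'I_m * 'I_m} | is_braid A && braid_noncrossing k A}.

(* Main.v *)
Require Import Defs.
From HB Require Import structures.
From mathcomp Require Import all_boot.

(** Moving every right endpoint one step to the left is a bijection from the
    arc sets on [m + 1] with i < j onto the arc sets on [m] with i <= j; it
    turns i_k < j_1 into i_k <= j_1 - 1, hence matches the two crossing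
    conditions. A set partition is the same thing as its arc
    set, the latter being any set of arcs i < j with distinct left endpoints
    and distinct right endpoints. The blocks are recovered as the
    chains of arcs: x <= y lie in one block iff a directed path of arcs leads
    from x to y. *)

(** When each vertex has at most one successor, two paths with the same start agree for as long as
    both last, so the shorter one is an initial piece of the longer one. *)
Lemma connect_comparable (T : finType) (e : rel T) (x y z : T) :
  (forall u v w, e u v -> e u w -> v = w) ->
  connect e x y -> connect e x z -> connect e y z || connect e z y.
Proof.
move=> e_fun /connectP[p]; elim: p x => [|u p IHp] x /=; first by move=> _ -> ->.
case/andP=> xu up def_y /connectP[[|v q] /=]; last case/andP=> xv vq def_z.
  move=> _ ->; rewrite [X in _ || X](_ : _ = true) ?orbT //.
  by apply/connectP; exists (u :: p); rewrite //= xu.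
by apply: (IHp u up def_y); apply/connectP; exists q; rewrite // (e_fun _ _ _ xu xv).
Qed.

Lemma connect_firststep {T : finType} {e : rel T} {x y : T} :
  connect e x y -> x = y \/ exists2 z, e x z & connect e z y.
Proof.
case/connectP=> [[|z p] /=]; first by move=> _ ->; left.
by case/andP=> xz zp def_y; right; exists z => //; apply/connectP; exists p.
Qed.

(** * Set partitions and their arc diagrams *)

Section Arcs.

Variable n : nat.
Implicit Types (P : {set {set 'I_n}}) (E : {set 'I_n * 'I_n}).

Definition diagram E : Prop :=
  [/\ {in E, forall a : 'I_n * 'I_n, a.1 < a.2},
      {in E &, injective (fun a : 'I_n * 'I_n => a.1)}
    & {in E &, injective (fun a : 'I_n * 'I_n => a.2)}].

Definition arc_rel E : rel 'I_n := fun x y => (x, y) \in E.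

Definition chain E : rel 'I_n :=
  fun x y => connect (arc_rel E) x y || connect (arc_rel E) y x.

Definition chain_partition E : {set {set 'I_n}} :=
  equivalence_partition (chain E) [set: 'I_n].

(** Only transitivity needs an argument, and only when the two paths leave from, or arrive at, a
    common vertex. Then uniqueness of arcs by left, respectively right, endpoint makes the other two
    ends comparable. *)
Lemma chain_equivalence E : diagram E ->
  {in [set: 'I_n] & &, equivalence_rel (chain E)}.
Proof.
case=> _ injl injr.
have fwd u v w : arc_rel E u v -> arc_rel E u w -> v = w.
  by move=> uv uw; case: (injl _ _ uv uw erefl).
have bwd u v w : arc_rel E v u -> arc_rel E w u -> v = w.
  by move=> vu wu; case: (injr _ _ vu wu erefl).
have chainC x y : chain E x y = chain E y x by rewrite /chain orbC.
have chainT x y z : chain E x y -> chain E y z -> chain E x z.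
  case/orP=> xy /orP[] yz.
  - by rewrite /chain (connect_trans xy yz).
  (* Both paths end at [y]; in the reversed relation they start there. *)
  - have := connect_comparable _ [rel u v | arc_rel E v u] y x z bwd.
    by rewrite !connect_rev /= chainC; apply.
  - exact: connect_comparable fwd xy yz.
  - by rewrite /chain (connect_trans yz xy) orbT.
move=> x y z _ _ _; split; first by rewrite /chain connect0.
move=> xy; apply/idP/idP; last exact: chainT.
by apply: chainT; rewrite chainC.
Qed.

Lemma chain_partitionP E : diagram E -> partition (chain_partition E) [set: 'I_n].
Proof. by move=> /chain_equivalence/equivalence_partitionP. Qed.

Lemma mem_partition_arcs P x y : partition P [set: 'I_n] ->
  ((x, y) \in partition_arcs P) =
  [&& x < y, y \in pblock P x & [forall l in pblock P x, ~~ (x < l < y)]].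
Proof.
case/and3P=> /eqP covP tiP _; rewrite inE /=; congr (_ && _).
apply/existsP/andP => [[B /and4P[PB Bx By B_l]] | [Py P_l]].
  by rewrite (def_pblock tiP PB Bx).
exists (pblock P x); rewrite Py P_l pblock_mem ?mem_pblock ?covP ?inE //.
Qed.

(** Two arcs sharing an endpoint lie in the same block. If they differed, the free end of the
    shorter one would be an element of that block strictly inside the longer one. *)
Lemma partition_arcs_diagram P :
  partition P [set: 'I_n] -> diagram (partition_arcs P).
Proof.
move=> partP; have [/eqP covP tiP _] := and3P partP.
split=> [a | [x y] [x' z] xy /[swap] /= <- xz | [x z] [y z'] xz /[swap] /= <- yz].
- by rewrite inE => /andP[].
- move: xy xz; rewrite !mem_partition_arcs //.
  case/and3P=> ltxy Py /forall_inP Pxy /and3P[ltxz Pz /forall_inP Pxz].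
  case: (ltngtP y z) => [ltyz | ltzy | /val_inj-> //].
    by have:= Pxz y Py; rewrite ltxy ltyz.
  by have:= Pxy z Pz; rewrite ltxz ltzy.
- move: xz yz; rewrite !mem_partition_arcs //.
  case/and3P=> ltxz Pxz /forall_inP Px /and3P[ltyz Pyz /forall_inP Py].
  have eqxy : pblock P x = pblock P y.
    by rewrite -(same_pblock tiP Pxz) (same_pblock tiP Pyz).
  have Pxx w : w \in pblock P w by rewrite mem_pblock covP inE.
  case: (ltngtP x y) => [ltxy | ltyx | /val_inj-> //].
    by have:= Px y; rewrite eqxy ltxy ltyz => /(_ (Pxx y)).
  by have:= Py x; rewrite -eqxy ltyx ltxz => /(_ (Pxx x)).
Qed.

Lemma connect_arc_leq E x y : diagram E -> connect (arc_rel E) x y -> x <= y.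
Proof.
case=> ltE _ _ /connectP[p]; elim: p x => [|z p IHp] x /=; first by move=> _ ->.
by case/andP=> /ltE/ltnW/leq_trans le_x zp def_y; apply: le_x; apply: IHp.
Qed.

(** If [y] follows [x] in its chain, the first step of the path from [x] to [y] cannot land strictly
    between them, so it lands on [y]. Conversely, given an arc from [x] to [y], a vertex of the
    chain either leads to [x], hence is at most [x], or is reached from [x], hence equals [x] or is
    at least [y]. *)
Lemma chain_partitionK E :
  diagram E -> partition_arcs (chain_partition E) = E.
Proof.
move=> dE; have [ltE injl _] := dE; have eqE := chain_equivalence _ dE.
apply/setP=> -[x y]; rewrite mem_partition_arcs ?chain_partitionP //.
have inP u v : (v \in pblock (chain_partition E) u) = chain E u v.
  by rewrite pblock_equivalence_partition ?inE.
apply/and3P/idP => [[ltxy] | Exy].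
  rewrite inP => /orP[|/(connect_arc_leq _ _ _ dE)]; last by rewrite leqNgt ltxy.
  case/connect_firststep=> [eqxy | [z Exz zy] /forall_inP noxy].
    by rewrite eqxy ltnn in ltxy.
  have:= noxy z; rewrite inP /chain connect1 // (ltE _ Exz) => /(_ isT).
  rewrite -leqNgt => leyz; suff ->: y = z by [].
  by apply/val_inj/eqP; rewrite /= eqn_leq leyz (connect_arc_leq _ _ _ dE).
rewrite inP /chain connect1 // (ltE _ Exy); split=> //.
apply/forall_inP=> l; rewrite inP negb_and -!leqNgt => /orP[|/(connect_arc_leq _ _ _ dE)->//].
case/connect_firststep=> [-> | [z Exz zl]]; first by rewrite leqnn.
have [-> ] := injl _ _ Exy Exz erefl.
by rewrite (connect_arc_leq _ _ _ dE zl) orbT.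
Qed.

Lemma pblock_connect P x y : partition P [set: 'I_n] ->
  y \in pblock P x -> x <= y -> connect (arc_rel (partition_arcs P)) x y.
Proof.
move=> partP; have [/eqP covP tiP _] := and3P partP.
have [d le_d] := ubnP (y - x); elim: d x le_d => // d IHd x le_d Py.
rewrite leq_eqVlt => /predU1P[/val_inj-> // | ltxy].
pose next l := (l \in pblock P x) && (x < l).
have next_y : next y by rewrite /next Py.
(* The least element [z] of the block beyond [x] is joined to [x] by an arc; the induction on
   [y - x] continues from [z]. *)
case: (arg_minnP (fun l : 'I_n => val l) next_y) => z /andP[Pz ltxz] minz.
have lezy := minz y next_y.
apply: (connect_trans (y := z)).
  apply: connect1; rewrite /arc_rel mem_partition_arcs // ltxz Pz /=.
  apply/forall_inP=> l Pl; rewrite negb_and -!leqNgt.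
  by case: leqP => //= ltxl; apply: minz; rewrite /next Pl.
apply: IHd => //; last by rewrite (same_pblock tiP Pz).
by rewrite ltnS in le_d; apply: leq_trans le_d; rewrite ltn_sub2l.
Qed.

Lemma connect_pblock P x y : partition P [set: 'I_n] ->
  connect (arc_rel (partition_arcs P)) x y -> y \in pblock P x.
Proof.
move=> partP; have [/eqP covP tiP _] := and3P partP.
case/connectP=> p; elim: p x => [|z p IHp] x /=.
  by move=> _ ->; rewrite mem_pblock covP inE.
case/andP; rewrite /arc_rel mem_partition_arcs // => /and3P[_ Pz _] zp def_y.
by rewrite -(same_pblock tiP Pz) IHp.
Qed.

Lemma partition_arcsK P :
  partition P [set: 'I_n] -> chain_partition (partition_arcs P) = P.
Proof.
move=> partP; have [/eqP covP tiP _] := and3P partP.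
rewrite -[RHS](equivalence_partition_pblock partP).
apply: eq_imset => x; apply/setP=> y; rewrite !inE /=.
have PC u v : v \in pblock P u -> u \in pblock P v.
  by move=> Pv; rewrite (same_pblock tiP Pv) mem_pblock covP inE.
apply/orP/idP => [[] /connect_pblock-/(_ partP) | Py] //; first exact: PC.
by case/orP: (leq_total x y) => le; [left | right]; apply: pblock_connect => //; apply: PC.
Qed.

End Arcs.

(** * Shifting right endpoints between braids and diagrams *)

Section Shift.

Variable m : nat.
Implicit Types (A : {set 'I_m * 'I_m}) (E : {set 'I_m.+1 * 'I_m.+1}).

(** Directed from braids to partitions, where the shift is total: [lift ord0] adds one to the right
    end, so a loop becomes an arc between neighbours. *)
Definition shift_arc (a : 'I_m * 'I_m) : 'I_m.+1 * 'I_m.+1 :=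
  (widen_ord (leqnSn m) a.1, lift ord0 a.2).

Lemma shift_arc_inj : injective shift_arc.
Proof.
by move=> [a b] [c d] [/val_inj-> /val_inj->].
Qed.

(** The inequality keeps [x] off the last vertex and [y] off the first, the only values that the
    shift misses. *)
Lemma shift_arc_surj (x y : 'I_m.+1) : x < y -> exists a, (x, y) = shift_arc a.
Proof.
move=> ltxy; have y0 : 0 < y by apply: leq_ltn_trans ltxy.
have lt_x : x < m by rewrite (leq_trans ltxy) // -ltnS.
have lt_y : y.-1 < m by rewrite -ltnS prednK.
exists (Ordinal lt_x, Ordinal lt_y).
by congr pair; apply: val_inj => //=; rewrite /bump /= add1n prednK.
Qed.

Lemma shift_arc_imset_preimset E :
  diagram _ E -> shift_arc @: (shift_arc @^-1: E) = E.
Proof.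
case=> ltE _ _; apply/setP=> -[x y]; apply/imsetP/idP => [[a] | Exy].
  by rewrite inE => Ea ->.
by have [a def_a] := shift_arc_surj x y (ltE _ Exy); exists a; rewrite // inE -def_a.
Qed.

(** The shift acts injectively on each coordinate separately, and i <= j amounts to i < j + 1, so
    the three conditions match one by one. *)
Lemma braidP A : is_braid A <-> diagram _ (shift_arc @: A).
Proof.
split=> [/and3P[/forall_inP leA /forall_inP injl /forall_inP injr]
        | [ltE injl injr]].
  split=> [_ /imsetP[a Aa ->] | _ _ /imsetP[a Aa ->] /imsetP[b Ab ->]
                              | _ _ /imsetP[a Aa ->] /imsetP[b Ab ->]].
  - exact: leA.
  - move/(congr1 val) => /= /eqP eq_ab.
    by have /forall_inP/(_ b Ab)/implyP/(_ eq_ab)/eqP-> := injl a Aa.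
  - move/lift_inj/eqP=> eq_ab.
    by have /forall_inP/(_ b Ab)/implyP/(_ eq_ab)/eqP-> := injr a Aa.
apply/and3P; split; apply/forall_inP=> a Aa.
- exact: (ltE _ (imset_f shift_arc Aa)).
- apply/forall_inP=> b Ab; apply/implyP=> /eqP eq_ab; apply/eqP/shift_arc_inj.
  by apply: (injl _ _ (imset_f _ Aa) (imset_f _ Ab)); rewrite /= eq_ab.
- apply/forall_inP=> b Ab; apply/implyP=> /eqP eq_ab; apply/eqP/shift_arc_inj.
  by apply: (injr _ _ (imset_f _ Aa) (imset_f _ Ab)); rewrite /= eq_ab.
Qed.

(** The comparison where the two lists meet is i_k < j_1 + 1, that is i_k <= j_1; as [s] is
    nonempty, [last] and [head] really are i_k and j_1. *)
Lemma shift_arc_ends (s : seq ('I_m * 'I_m)) : 0 < size s ->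
  sorted ltn (left_ends (map shift_arc s) ++ right_ends (map shift_arc s)) =
  [&& sorted ltn (left_ends s), last 0 (left_ends s) <= head 0 (right_ends s)
    & sorted ltn (right_ends s)].
Proof.
have -> : left_ends (map shift_arc s) = left_ends s.
  by rewrite /left_ends -map_comp.
have -> : right_ends (map shift_arc s) = map succn (right_ends s).
  by rewrite /right_ends -!map_comp; apply: eq_map => a.
case: s => //= a s _; rewrite cat_path /=; congr [&& _, _ & _].
by rewrite path_map.
Qed.

Lemma shift_crossing k A : 0 < k ->
  [exists s : k.-tuple ('I_m.+1 * 'I_m.+1), all (mem (shift_arc @: A)) s &&
      sorted ltn (left_ends s ++ right_ends s)] =
  [exists s : k.-tuple ('I_m * 'I_m),
        [&& all (mem A) s, sorted ltn (left_ends s),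
            last 0 (left_ends s) <= head 0 (right_ends s) &
            sorted ltn (right_ends s)]].
Proof.
move=> k_gt0; apply/existsP/existsP => [[s /andP[As srt]] | [s /andP[As srt]]].
  (* All arcs of [s] are shifted arcs of [A], so the crossing is pulled back entry by entry. *)
  have [t def_s At] : exists2 t, map shift_arc t = s & all (mem A) t.
    elim: {srt}(val s) As => [|x u IHu] /=; first by exists [::].
    case/andP=> /imsetP[a Aa ->] /IHu[t <- At]; exists (a :: t) => //=.
    by rewrite Aa.
  have sz_t : size t == k by rewrite -(size_map shift_arc) def_s size_tuple.
  exists (Tuple sz_t); rewrite /= At /=.
  by move: srt; rewrite -def_s shift_arc_ends // (eqP sz_t).
exists (map_tuple shift_arc s); rewrite /= shift_arc_ends ?size_tuple // srt andbT.
by rewrite all_map; apply: sub_all As => a Aa; apply: imset_f.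
Qed.

(** The truncated subtraction is harmless: for j = 0 and j = 1 the right side asks for the label 0,
    while shifted arcs have right label at least 2, so both sides are false. *)
Lemma has_arc_shift A i j :
  has_arc (shift_arc @: A) i j = has_arc A i (j - 1).
Proof.
apply/exists_inP/exists_inP => [[_ /imsetP[a Aa ->] /andP[/= ai /eqP<-]] |].
  by exists a; rewrite // ai subn1 /=.
case=> a Aa /andP[ai aj]; exists (shift_arc a); first exact: imset_f.
by rewrite /= ai; case: j aj => [|j]; rewrite subn1.
Qed.

End Shift.

Theorem theorem3p1 (k n : nat) (hk : 3 <= k) (hn : 0 < n) :
  exists theta : kpartition k n -> kbraid k (n - 1),
    bijective theta /\
    forall (p : kpartition k n) (i j : nat),
      has_arc (partition_arcs (sval p)) i j <->
      has_arc (sval (theta p)) i (j - 1).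
Proof.
have k_gt0 : 0 < k by apply: leq_trans hk.
case: n hn => // m _; rewrite [m.+1 - 1]subn1 /=.
pose braid_of (P : {set {set 'I_m.+1}}) := shift_arc m @^-1: partition_arcs P.
pose partition_of (A : {set 'I_m * 'I_m}) := chain_partition _ (shift_arc m @: A).
have shift_braid P : partition P [set: 'I_m.+1] ->
    shift_arc m @: braid_of P = partition_arcs P.
  by move=> /partition_arcs_diagram/shift_arc_imset_preimset.
have braidK P : partition P [set: 'I_m.+1] -> partition_of (braid_of P) = P.
  by move=> partP; rewrite /partition_of shift_braid // partition_arcsK.
have arcs_of A : is_braid A -> partition_arcs (partition_of A) = shift_arc m @: A.
  by move=> /braidP; apply: chain_partitionK.
have braid_ok (p : kpartition k m.+1) :
    is_braid (braid_of (sval p)) && braid_noncrossing k (braid_of (sval p)).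
  case: p => P /= /andP[partP ncP]; apply/andP; split.
    by apply/braidP; rewrite shift_braid //; apply: partition_arcs_diagram.
  by rewrite /braid_noncrossing -shift_crossing // shift_braid.
have partition_ok (b : kbraid k m) :
    partition (partition_of (sval b)) [set: 'I_m.+1]
    && partition_noncrossing k (partition_of (sval b)).
  case: b => A /= /andP[brA ncA]; apply/andP; split.
    by apply/chain_partitionP/braidP.
  by rewrite /partition_noncrossing arcs_of // shift_crossing.
pose theta p : kbraid k m :=
  exist (fun A => is_braid A && braid_noncrossing k A) _ (braid_ok p).
pose theta_inv b : kpartition k m.+1 :=
  exist (fun P => partition P [set: 'I_m.+1] && partition_noncrossing k P)
    _ (partition_ok b).
exists theta; split.
  exists theta_inv.
    case=> P okP; apply: val_inj => /=; apply: braidK.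
    by case/andP: okP.
  case=> A okA; apply: val_inj => /=; have [brA _] := andP okA.
  (* The partition built from [A] has the shifted arcs of [A], and taking the preimage under an
     injective map undoes the image. *)
  apply/setP=> a; rewrite inE arcs_of // mem_imset //.
  exact: shift_arc_inj.
case=> P okP i j /=; have [partP _] := andP okP.
by rewrite -has_arc_shift shift_braid.
Qed.
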